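(* Let $\mu$ be a translation-invariant probability measure on bi-infinite simple paths in the $\mathbb{Z}^2$ lattice, such that $\mu$-almost every path intersects every integer translate of each of the four half-axes (positive $x$-axis, negative $x$-axis, positive $y$-axis, negative $y$-axis) infinitely many times. Then for $\mu$-almost every path $P$ and every lattice point $p$ of $P$ there is a constant $c=c(p,P)>0$ such that for infinitely many $n\in\mathbb{N}$ the length of the $n$-th snail of $p$ is at least $cn^2$.
   Context: A bi-infinite simple path is a subgraph of the square lattice isomorphic to the graph $\mathbb{Z}$. Let $P$ be such a path intersecting every integer translate (in both coordinate directions) of each of the four half-axes infinitely many times. Let $p=(a,b)$ be a vertex of $P$ and $n$ a positive integer. Order the vertices of $P$ lying on the half-line $\{(s,b): s>a\}$ by their distance from $p$, and let $p_n^{x_+}$ be the $n$-th closest to $p$. Define $p_n^{x_-},p_n^{y_+},p_n^{y_-}$ similarly, using the half-lines from $p$ in the negative $x$, positive $y$ and negative $y$ directions. The $n$-th cross of $p$ is the union of the line segment connecting $p_n^{x_+}$ and $p_n^{x_-}$ and the line segment connecting $p_n^{y_+}$ and $p_n^{y_-}$. The $n$-th snail of $p$ is the smallest (with respect to inclusion) connected subgraph of the path $P$ that contains $p$ and all the vertices of $P$ lying on the $n$-th cross of $p$. The length of a snail is the number of path edges included in it. Translation-invariance is with respect to all $\mathbb{Z}^2$-translations. *)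

(* Defs.v *)
From HB Require Import structures.
From mathcomp Require Import all_boot all_order all_algebra.
From mathcomp Require Import all_classical all_reals all_analysis.
From mathcomp Require Import zify.

Set Implicit Arguments.
Unset Strict Implicit.
Unset Printing Implicit Defensive.

Import Order.TTheory GRing.Theory Num.Theory.

Local Open Scope classical_set_scope.
Local Open Scope card_scope.
Local Open Scope ring_scope.

Definition vertex := (int * int)%type.

Definition translate (z : vertex) (A : set vertex) : set vertex :=
  [set z + v | v in A].

(* An edge is the two-element set of its endpoints. *)
Definition lattice_edges : set (set vertex) :=
  [set [set w.1; w.2] | w in
    [set w : vertex * vertex | `|w.1.1 - w.2.1| + `|w.1.2 - w.2.2| = 1]].

Record subgraph := Subgraph {
  vset : set vertex;
  eset : set (set vertex);
  eset_lattice : eset `<=` lattice_edges;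
  eset_vset : forall e, eset e -> e `<=` vset }.

(* f is an isomorphism onto G from the graph Z, where i and j are adjacent iff
   |i - j| = 1. *)
Definition iso_Z (G : subgraph) : Prop :=
  exists f : int -> vertex, [/\ injective f, range f = vset G &
    forall i j : int, eset G [set f i; f j] <-> `|i - j| = 1].

Record bipath := Bipath { bipath_graph :> subgraph; bipathP : iso_Z bipath_graph }.

Lemma translateK (z : vertex) (A : set vertex) :
  translate (- z) (translate z A) = A.
Proof.
apply/seteqP; split=> [_ [_ [v Av <-] <-]|v Av]; first by rewrite addKr.
by exists (z + v); [exists v | rewrite addKr].
Qed.

Lemma translate2 (z u v : vertex) :
  translate z [set u; v] = [set z + u; z + v].
Proof. by rewrite /translate image_setU !image_set1. Qed.

Definition shift_eset (z : vertex) (E : set (set vertex)) : set (set vertex) :=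
  [set translate z e | e in E].

Lemma shift_eset_lattice z (G : subgraph) :
  shift_eset z (eset G) `<=` lattice_edges.
Proof.
case: z => z1 z2 _ [e /eset_lattice[[[a b] [c d]] uv <-] <-].
exists ((z1, z2) + (a, b), (z1, z2) + (c, d)); last by rewrite translate2.
change (`|(z1 + a) - (z1 + c)| + `|(z2 + b) - (z2 + d)| = 1 :> int).
have subDD (x y t : int) : (x + y) - (x + t) = y - t by lia.
by rewrite !subDD.
Qed.

Lemma shift_eset_vset z (G : subgraph) e :
  shift_eset z (eset G) e -> e `<=` translate z (vset G).
Proof. by move=> [e' /eset_vset e'G <-]; apply: image_subset. Qed.

Definition shift_subgraph (z : vertex) (G : subgraph) : subgraph :=
  Subgraph (@shift_eset_lattice z G) (@shift_eset_vset z G).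

Lemma shift_iso_Z z (P : bipath) : iso_Z (shift_subgraph z P).
Proof.
have [f [finj frange fE]] := bipathP P.
exists (fun i => z + f i); split=> [i j /addrI/finj//||i j].
  by rewrite /= -frange /translate -image_comp.
rewrite -fE -translate2; split=> [[e Ee /(congr1 (translate (- z)))]|Eij].
  by rewrite !translateK => <-.
by exists [set f i; f j].
Qed.

Definition shift (z : vertex) (P : bipath) : bipath :=
  Bipath (shift_iso_Z z P).

Definition xaxis_eset : set (set vertex) :=
  [set [set (i, 0); (i + 1, 0)] | i in [set: int]].

Lemma xaxis_eset_lattice : xaxis_eset `<=` lattice_edges.
Proof.
move=> _ [i _ <-]; exists ((i, 0), (i + 1, 0)) => //.
have adj : `|i - (i + 1)| + `|(0 : int) - (0 : int)| = 1 by lia.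
exact: adj.
Qed.

Lemma xaxis_eset_vset e : xaxis_eset e -> e `<=` [set v | v.2 = 0].
Proof. by move=> [i _ <-] v [] ->. Qed.

Definition xaxis_subgraph : subgraph :=
  Subgraph xaxis_eset_lattice xaxis_eset_vset.

Lemma xaxis_iso_Z : iso_Z xaxis_subgraph.
Proof.
exists (fun i => (i, 0)); split=> [i j [] //||i j].
  by apply/seteqP; split=> [_ [i _ <-] //|[a b] /= ->]; exists a.
split=> [[k _ ke]|].
  have : [set (k, 0); (k + 1, 0)] ((i, 0) : vertex) by rewrite ke; left.
  have : [set (k, 0); (k + 1, 0)] ((j, 0) : vertex) by rewrite ke; right.
  have : [set (i, 0); (j, 0)] ((k, 0) : vertex) by rewrite -ke; left.
  have : [set (i, 0); (j, 0)] ((k + 1, 0) : vertex) by rewrite -ke; right.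
  by move=> [] [e1] [] [e2] [] [e3] [] [e4]; lia.
case: (ltrP i j) => ij ijE; [exists i => //|exists j => //].
  by have -> : j = i + 1 by lia.
have -> : i = j + 1 by lia.
by rewrite setUC.
Qed.

HB.instance Definition _ := gen_eqMixin bipath.
HB.instance Definition _ := gen_choiceMixin bipath.
HB.instance Definition _ := isPointed.Build bipath (Bipath xaxis_iso_Z).

(* Cylinder events: a given vertex, or a given edge, belongs to the path. *)
Definition bipath_cylinders : set (set bipath) :=
  [set [set P : bipath | vset P v] | v in [set: vertex]] `|`
  [set [set P : bipath | eset P e] | e in [set: set vertex]].

Definition path_space := g_sigma_algebraType bipath_cylinders.

Definition translation_invariant (R : realType) (mu : probability path_space R) :=
  forall (z : vertex) (A : set path_space),
    measurable A -> mu (shift z @^-1` A) = mu A.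

Inductive direction := xpos | xneg | ypos | yneg.

Definition half_axis (d : direction) : set vertex :=
  match d with
  | xpos => [set v | 0 < v.1 /\ v.2 = 0]
  | xneg => [set v | v.1 < 0 /\ v.2 = 0]
  | ypos => [set v | v.1 = 0 /\ 0 < v.2]
  | yneg => [set v | v.1 = 0 /\ v.2 < 0]
  end.

Definition meets_half_axes (P : bipath) : Prop :=
  forall (d : direction) (z : vertex),
    infinite_set (vset P `&` translate z (half_axis d)).

Section snail.
Variable R : realType.

Definition point (v : vertex) : R * R := (v.1%:~R, v.2%:~R).

Definition dist (u v : vertex) : R :=
  Num.sqrt (((point u).1 - (point v).1) ^+ 2 + ((point u).2 - (point v).2) ^+ 2).

(* q is the n-th closest to p (counting from 1) among the vertices of P on the
   half-line from p in direction d; the half-line does not contain p. *)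
Definition nth_vertex (P : bipath) (p : vertex) (n : nat) (d : direction)
    (q : vertex) : Prop :=
  let A := vset P `&` translate p (half_axis d) in
  A q /\ [set v | A v /\ dist p v <= dist p q] #= `I_n.

Definition segment (x y : R * R) : set (R * R) :=
  [set ((1 - t) * x.1 + t * y.1, (1 - t) * x.2 + t * y.2) | t in `[0, 1]].

Definition nth_cross (P : bipath) (p : vertex) (n : nat) (C : set (R * R)) : Prop :=
  exists2 q : direction -> vertex, (forall d, nth_vertex P p n d (q d)) &
    C = segment (point (q xpos)) (point (q xneg)) `|`
        segment (point (q ypos)) (point (q yneg)).

Definition included (G H : subgraph) : Prop :=
  vset G `<=` vset H /\ eset G `<=` eset H.

Definition connected_graph (G : subgraph) : Prop :=
  vset G !=set0 /\
  forall u v, vset G u -> vset G v ->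
    exists2 s : seq vertex, path (fun x y => [set x; y] \in eset G) u s & last u s = v.

Definition nth_snail (P : bipath) (p : vertex) (n : nat) (S : subgraph) : Prop :=
  exists2 C : set (R * R), nth_cross P p n C &
    let admissible (H : subgraph) :=
      [/\ included H P, connected_graph H, vset H p &
          forall v, vset P v -> C (point v) -> vset H v] in
    admissible S /\ forall H, admissible H -> included S H.

End snail.

Definition has_length (S : subgraph) (l : nat) : Prop := eset S #= `I_l.

(* Main.v *)
(* Let Q_k(p), called eventually_short k p below, be the event that p lies on the
   path and that, for all large n, the path vertices at distance at most n from p
   on the row and column of p are reached from p within n^2 / k steps along the
   path.  The n-th cross of p contains all these vertices, so if the n-th snail
   has length less than n^2 / k for all large n, then Q_k(p) occurs.

   Fix n and let S be the set of the vertices p in an n x n box from which the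
   path vertices of the box on the row and column of p are reached within
   m = n^2 / k steps.  Count the triples (s, u, t) in S with s, u in one row and
   u, t in one column.  There are at least |S|^3 / (32 n^2) of them, since at
   least half of S lies on rows and columns that each contain |S| / (4 n) points
   of S.  On the other hand s and t determine u and are at most 2 m steps apart,
   so there are at most |S| (4 m + 1) triples.  Hence |S|^2 <= 32 n^2 (4 m + 1),
   which is at most (160 / k) n^4 once n^2 >= k.  Averaging over the box, by
   translation invariance each Q_k(p) has probability at most sqrt (160 / k). *)
Require Import Defs.
From mathcomp Require Import all_boot all_order all_algebra.
From mathcomp Require Import all_classical all_reals all_analysis.
From mathcomp Require Import measurable_realfun zify ring lra.

Import Order.TTheory GRing.Theory Num.Theory.

Local Open Scope classical_set_scope.
Local Open Scope ring_scope.

(** * Counting points in a grid *)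

Section grid.
Local Open Scope nat_scope.

(** Each of the [#|T|] lines that is sparse carries fewer than [#|S| / (4 * #|T|)] points of [S], so
    all sparse lines together carry at most a quarter of [S]. *)
Lemma sparse_line_card {I T : finType} (S : {set I}) (line : I -> T) :
  4 * (\sum_(u in S) (4 * #|T| * (\sum_(t in S) (line t == line u)) < #|S|))
    <= #|S|.
Proof.
have [T0|T0] := posnP #|T|.
  rewrite big1// => u; by have := fintype0 (line u) T0.
rewrite -(leq_pmul2l T0) mulnA [(#|T| * 4)%N]mulnC.
pose N i := \sum_(t in S) (line t == i).
rewrite (partition_big line predT)//= big_distrr/= -sum_nat_const leq_sum// => i _.
apply: (@leq_trans (4 * #|T| * (N i * (4 * #|T| * N i < #|S|)))).
  rewrite leq_mul2l; apply/orP; right.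
  rewrite [leqRHS]mulnC big_distrr/= [leqRHS](bigID (fun t => line t == i))/=.
  apply: leq_trans (leq_addr _ _); apply: leq_sum => u /andP[_ /eqP ui].
  by rewrite ui eqxx muln1.
by case: ltnP => [/ltnW|]; rewrite ?muln1 ?muln0.
Qed.

(** The offset [idx t - idx s + d] sends these points injectively into the [2 * d + 1] integers from
    [0] to [2 * d]. *)
Lemma close_card {I : finType} (S : {set I}) (idx : I -> int) (d : nat) (s : I) :
  {in S &, injective idx} ->
  \sum_(t in S) (`|idx s - idx t|%R <= d%:Z)%R <= d.*2.+1.
Proof.
move=> inj.
pose g t := inord (absz (idx t - idx s + d%:Z)%R) : 'I_(d.*2.+1).
rewrite -big_mkcondr/= sum1_card.
rewrite -[leqRHS]card_ord -(@card_in_imset _ _ g).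
  exact: max_card.
move=> t u /andP[tS td] /andP[uS ud] /(congr1 val) /=.
rewrite !inordK; [|lia|lia] => e; apply: inj => //; lia.
Qed.

Lemma grid_count {I J : finType} (S : {set I * J}) (idx : I * J -> int) (m : nat) :
  {in S &, injective idx} ->
  (forall s u, s \in S -> u \in S -> s.1 = u.1 \/ s.2 = u.2 ->
     `|idx s - idx u|%R <= m%:Z)%R ->
  #|S| ^ 2 <= 32 * (#|I| * #|J|) * (4 * m + 1).
Proof.
move=> inj near.
pose r (u : I * J) := \sum_(t in S) (t.1 == u.1).
pose c (u : I * J) := \sum_(t in S) (t.2 == u.2).
(* The sum counts the triples [(s, u, t)]. After exchanging sums, only [u = (s.1, t.2)] can
   contribute, and then [s] and [t] are at most [2 * m] apart through [u]. *)
have upper : \sum_(u in S) r u * c u <= #|S| * (4 * m + 1).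
  have -> : \sum_(u in S) r u * c u =
     \sum_(s in S) \sum_(t in S) \sum_(u in S) (s.1 == u.1) * (t.2 == u.2).
    transitivity (\sum_(u in S) \sum_(s in S) \sum_(t in S)
        (s.1 == u.1) * (t.2 == u.2)).
      apply: eq_bigr => u _; rewrite big_distrl/=; apply: eq_bigr => s _.
      by rewrite big_distrr.
    rewrite exchange_big/=; apply: eq_bigr => s _.
    by rewrite exchange_big.
  rewrite -sum_nat_const; apply: leq_sum => s sS.
  have -> : 4 * m + 1 = (2 * m).*2.+1 by lia.
  apply: leq_trans (close_card S idx (2 * m) s inj).
  apply: leq_sum => t tS.
  case: (boolP ((s.1, t.2) \in S)) => stS; last first.
    rewrite big1// => -[i j] uS /=; case: eqP => //= si; case: eqP => //= tj.
    by move: stS; rewrite si tj uS.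
  rewrite (bigD1 (s.1, t.2))//= !eqxx big1 ?addn0; last first.
    move=> [i j] /andP[uS ne] /=; case: eqP => //= si; case: eqP => //= tj.
    by move: ne; rewrite si tj eqxx.
  have := near s (s.1, t.2) sS stS (or_introl erefl).
  have := near (s.1, t.2) t stS tS (or_intror erefl).
  lia.
have lower : #|S| ^ 3 <= 32 * (#|I| * #|J|) * \sum_(u in S) r u * c u.
  pose lr (u : I * J) : nat := 4 * #|I| * r u < #|S|.
  pose lc (u : I * J) : nat := 4 * #|J| * c u < #|S|.
  have Lr : 4 * \sum_(u in S) lr u <= #|S| by exact: sparse_line_card.
  have Lc : 4 * \sum_(u in S) lc u <= #|S| by exact: sparse_line_card.
  (* Pointwise bound: a point on a sparse line is paid for by the error term. Any other point has
     [r u >= #|S| / (4 * #|I|)] and [c u >= #|S| / (4 * #|J|)]. The errors add up to at most half of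
     [#|S| ^ 3], which turns 16 into 32. *)
  have : #|S| ^ 3 <= \sum_(u in S)
     (16 * (#|I| * #|J|) * (r u * c u) + #|S|^2 * (lr u + lc u)).
    rewrite (expnS _ 2) -sum_nat_const; apply: leq_sum => u _.
    rewrite /lr /lc; case: ltnP => hr; first by lia.
    case: ltnP => hc; first by lia.
    have := leq_mul hr hc; lia.
  rewrite big_split/= -!big_distrr/= big_split/= => h.
  have : #|S| ^ 2 * (2 * (\sum_(u in S) lr u + \sum_(u in S) lc u)) <= #|S| ^ 3.
    by rewrite (expnSr _ 2) leq_mul2l; apply/orP; right; lia.
  rewrite mulnCA; move: h; set X := (#|S| ^ 2 * _)%N; rewrite -!mulnA.
  set D := (#|I| * _)%N. by move: X D (#|S| ^ 3) => X D K; lia.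
have [->|S0] := posnP #|S|; first by rewrite exp0n.
rewrite -(leq_pmul2r S0) -expnSr.
apply: leq_trans lower _.
by rewrite -[leqRHS]mulnA leq_mul2l; apply/orP; right; rewrite mulnC.
Qed.

End grid.

(** * Walks along a path *)

Definition parametrizes (f : int -> vertex) (G : subgraph) : Prop :=
  [/\ injective f, range f = vset G &
    forall i j : int, eset G [set f i; f j] <-> `|i - j| = 1].

(** The list [s] omits the starting vertex, so [size s] is the number of steps. *)
Definition walk (G : subgraph) (u v : vertex) (s : seq vertex) : Prop :=
  path (fun x y => [set x; y] \in eset G) u s /\ last u s = v.

Lemma walk_rev G u v s : walk G u v s ->
  exists2 s', walk G v u s' & size s' = size s.
Proof.
move=> [us <-]; exists (rev (belast u s)); last by rewrite size_rev size_belast.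
split.
  rewrite rev_path; apply: sub_path us => x y /=.
  by rewrite setUC.
case: s us => //= x s _.
by rewrite rev_cons last_rcons.
Qed.

Lemma interval_walk G f (i j : int) : i <= j ->
  (forall k, i <= k < j -> eset G [set f k; f (k + 1)]) ->
  exists2 s, walk G (f i) (f j) s & (size s)%:Z = j - i.
Proof.
move=> ij; have [d ->] : exists d : nat, j = i + d%:Z.
  by exists (absz (j - i)); lia.
elim: d i {ij} => [|d IH] i edges; first by exists [::]; rewrite ?addr0 ?subrr.
have [|s [ps ls] ss] := IH (i + 1).
- by move=> k /andP[k1 k2]; apply: edges; lia.
exists (f (i + 1) :: s) => /=; last by rewrite -[LHS]/((size s).+1%:Z); lia.
split => //=; first by rewrite ps andbT inE; apply: edges; lia.
by rewrite ls; congr f; lia.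
Qed.

Lemma interval_connected {G f} (i j a b : int) :
  a <= i <= b -> a <= j <= b ->
  (forall k, a <= k < b -> eset G [set f k; f (k + 1)]) ->
  exists2 s, walk G (f i) (f j) s & (size s)%:Z = `|i - j|.
Proof.
move=> iab jab edges; case: (lerP i j) => ij.
  have [|s ws ss] := @interval_walk G f i j ij.
    by move=> k kij; apply: edges; lia.
  by exists s => //; lia.
have [|s ws ss] := @interval_walk G f j i (ltW ij).
  by move=> k kij; apply: edges; lia.
have [s' ws' ss'] := walk_rev _ _ _ _ ws.
by exists s' => //; lia.
Qed.

Section parametrized.
Context {P : bipath} {f : int -> vertex}.
Hypothesis fP : parametrizes f P.

Lemma param_edge k : eset P [set f k; f (k + 1)].
Proof. by case: fP => _ _ ->; lia. Qed.

Lemma param_vset i : vset P (f i).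
Proof. by case: fP => _ <- _; exists i. Qed.

Lemma param_surj v : vset P v -> exists i, f i = v.
Proof. by case: fP => _ <- _ [i _ <-]; exists i. Qed.

Lemma param_inj : injective f. Proof. by case: fP. Qed.

Lemma edge_next G x i : included G P -> [set f i; x] \in eset G ->
  exists2 j, x = f j & `|i - j| = 1.
Proof.
move=> [_ GP] /set_mem/GP e.
have /param_surj[j jx] : vset P x by apply: (eset_vset e); right.
by exists j => //; case: fP => _ _ <-; rewrite jx.
Qed.

Lemma walk_dist i j s : walk P (f i) (f j) s -> `|i - j| <= (size s)%:Z.
Proof.
have PP : included P P by split.
case; elim: s i => [|x s IH] i /=.
  by move=> _ /param_inj ->; rewrite subrr.
move=> /andP[/(edge_next P _ _ PP)[k -> ik] /IH/[apply]] h.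
rewrite -[leRHS]/((size s).+1%:Z); lia.
Qed.

(** Discrete intermediate value argument: each step changes the parameter by exactly 1, so a walk
    from [i] to [j] must cross from [k] to [k + 1]. *)
Lemma walk_cover G i j k s : included G P -> walk G (f i) (f j) s ->
  i <= k < j -> eset G [set f k; f (k + 1)].
Proof.
move=> GP [+ +] /andP[+ kj]; elim: s i => [|x s IH] i /=.
  by move=> _ /param_inj -> ?; lia.
move=> /andP[e]; have /(edge_next G _ _ GP)[l xl il] := e.
rewrite xl => ps ls ik.
case: (lerP l k) => lk; first exact: IH ps ls lk.
have -> : k = i by lia.
by have <- : l = i + 1 by [lia]; rewrite -xl; exact: set_mem.
Qed.

End parametrized.

(** A substitute for the [n]-th cross that does not depend on the path. Its vertices lie on the
    [n]-th cross, because the [n]-th path vertex on a ray is at distance at least [n]. *)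
Definition lattice_cross (q : vertex) (n : nat) : set vertex :=
  [set v | [/\ v.1 = q.1 \/ v.2 = q.2, `|v.1 - q.1| <= n%:Z & `|v.2 - q.2| <= n%:Z]].

Definition short_cross (k n : nat) (q : vertex) : set bipath :=
  [set P | vset P q /\ forall v, vset P v -> lattice_cross q n v ->
     exists2 s, walk P q v s & (k * size s <= n ^ 2)%N].

Lemma short_cross_count (P : bipath) (k n : nat) : (0 < k)%N ->
  ((\sum_(ij : 'I_n * 'I_n) `[< short_cross k n (ij.1%:Z, ij.2%:Z) P >]) ^ 2
    <= 32 * n ^ 2 * (4 * (n ^ 2 %/ k) + 1))%N.
Proof.
move=> k0; have [f fP] := bipathP P.
(* [g] inverts [f] on the path and is unconstrained elsewhere. It serves as the index function in
   [grid_count]. *)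
have [|g gP] := @boolp.choice _ _ (fun v i => vset P v -> f i = v).
  move=> v.
  have [/(param_surj fP)[i fi]|nv] := pselect (vset P v); first by exists i.
  by exists 0.
pose q (ij : 'I_n * 'I_n) : vertex := (ij.1%:Z, ij.2%:Z).
pose S : {set 'I_n * 'I_n} := finset (fun ij => `[< short_cross k n (q ij) P >]).
have SP ij : ij \in S -> short_cross k n (q ij) P.
  by rewrite finset.inE => /asboolP.
have -> : (\sum_ij `[< short_cross k n (q ij) P >] = #|S|)%N.
  rewrite -sum1_card -big_mkcond/=; apply: eq_bigl => ij.
  by rewrite finset.inE.
have := @grid_count 'I_n 'I_n S (g \o q) (n ^ 2 %/ k)%N.
rewrite card_ord; apply.
- move=> s u /SP[sP _] /SP[uP _] /= /(congr1 f); rewrite !gP// => -[].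
  by case: s u {sP uP} => [s1 s2] [u1 u2] /= /ord_inj -> /ord_inj ->.
- move=> s u /SP[sP sE] /SP[uP _] su /=.
  (* Coordinates in the box differ by less than [n], so box points sharing a row or column lie on
     each other's lattice crosses. *)
  have close (a b : 'I_n) : `|a%:Z - b%:Z| <= n%:Z.
    by have := ltn_ord a; have := ltn_ord b; lia.
  have [|w] := sE (q u) uP.
    split; [|exact: close|exact: close].
    by rewrite /q/=; case: su => ->; [left|right].
  rewrite -{1}(gP _ sP) -{1}(gP _ uP) => /(walk_dist fP) h kw.
  apply: le_trans h _.
  by rewrite lez_nat leq_divRL// mulnC.
Qed.

(** * Existence of snails *)

Lemma infinite_nat_nth (K : set nat) (n : nat) : infinite_set K -> (0 < n)%N ->
  exists N, K N /\ ([set k | K k /\ (k <= N)%N] #= `I_n)%card.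
Proof.
move=> Kinf n0; pose b k := `[< K k >].
have unbounded M : exists2 k, K k & (M <= k)%N.
  have [] := infinite_setN0 (@infinite_setD _ K `I_M Kinf (finite_II M)).
  by move=> k [Kk /negP]; rewrite -leqNgt; exists k.
have [M Mn] : exists M, (n <= count b (iota 0 M))%N.
  elim: n {n0} => [|m [M IH]]; first by exists 0%N.
  have [k Kk Mk] := unbounded M; exists k.+1.
  rewrite -[k.+1]addn1 iotaD count_cat/= add0n.
  rewrite (_ : b k = true) ?addn0 ?addn1 ?ltnS; last exact/asboolP.
  rewrite -(subnKC Mk) iotaD count_cat.
  by apply: leq_trans IH _; exact: leq_addr.
have ex : exists M, (n <= count b (iota 0 M))%N by exists M.
(* The least [M] with at least [n] elements of [K] below it is a successor [N.+1]. Minimality forces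
   [N] into [K] and makes the count exactly [n]. *)
case: (ex_minnP ex) => -[|N] nN minN; first by move: nN; rewrite leqNgt n0.
have cN : (count b (iota 0 N) < n)%N.
  by rewrite ltnNge; apply/negP => /minN; rewrite ltnn.
move: nN; rewrite -[N.+1]addn1 iotaD count_cat/= addn0 add0n => nN.
have bN : b N by case: (b N) nN => //; rewrite addn0 leqNgt cN.
exists N; split; first exact/asboolP.
pose s := [seq k <- iota 0 N.+1 | b k].
have ss : size s = n.
  rewrite size_filter -(addn1 N) iotaD count_cat/= addn0 add0n bN.
  by apply/eqP; rewrite addn1 eqn_leq cN -addn1; move: nN; rewrite bN.
rewrite -ss.
have -> : [set k | K k /\ (k <= N)%N] = nth 0%N s @` `I_(size s).
  apply/seteqP; split=> [k [Kk kN]|_ [i /= si <-]].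
    have ks : k \in s.
      by rewrite mem_filter mem_iota/= add0n ltnS kN andbT; exact/asboolP.
    by exists (index k s); rewrite /= ?index_mem ?nth_index.
  have := mem_nth 0%N si; rewrite mem_filter mem_iota add0n ltnS => /andP[/asboolP].
  by move=> ?; split.
apply: inj_card_eq => i j; rewrite !inE/= => si sj /eqP.
by rewrite nth_uniq ?filter_uniq ?iota_uniq// => /eqP.
Qed.

Definition ray (d : direction) (k : nat) : vertex :=
  match d with
  | xpos => (k%:Z, 0) | xneg => (- k%:Z, 0) | ypos => (0, k%:Z) | yneg => (0, - k%:Z)
  end.

Lemma half_axisE d : half_axis d = ray d @` [set k | (0 < k)%N].
Proof.
apply/seteqP; split.
  by move=> [x y]; case: d => /= -[h1 h2]; [exists (absz x)|exists (absz x)|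
    exists (absz y)|exists (absz y)] => /=; try (by lia); congr pair; lia.
by move=> _ [k /= k0 <-]; case: d => /=; lia.
Qed.

Lemma ray_inj d : injective (ray d).
Proof. by case: d => i j /= [] //; lia. Qed.

Section crosses.
Variable R : realType.

Lemma dist_ray p d k : dist R p (p + ray d k) = k%:R.
Proof.
case: p => x y; rewrite /dist /Defs.point; case: d => /=;
  rewrite ?addr0 ?subrr ?expr0n ?addr0 ?add0r ?sqrtr_sqr ?intrD ?rmorphN /=;
  rewrite opprD addrA subrr add0r ?opprK ?normrN normr_nat //.
Qed.

Lemma nth_vertex_exists (P : bipath) p n d :
  infinite_set (vset P `&` translate p (half_axis d)) -> (0 < n)%N ->
  exists2 N, (n <= N)%N & nth_vertex R P p n d (p + ray d N).
Proof.
set A := vset P `&` _ => Ainf n0.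
pose K := [set k : nat | (0 < k)%N /\ vset P (p + ray d k)].
have AE : A = (fun k => p + ray d k) @` K.
  rewrite /A half_axisE /translate; apply/seteqP; split.
    by move=> v [Pv [_ [k k0 <-] kv]]; exists k => //; split => //; rewrite kv.
  by move=> _ [k [k0 Pk] <-]; split => //; exists (ray d k) => //; exists k.
have Kinf : infinite_set K by move=> Kfin; apply: Ainf; rewrite AE; exact: finite_image.
have [N [[N0 PN] Nn]] := @infinite_nat_nth K n Kinf n0.
exists N.
  (* The [n] selected indices are positive and at most [N], hence [n <= N]. *)
  rewrite -card_le_II -(card_le_eql Nn).
  apply: (@card_le_trans _ _ _ (S @` `I_N)) (card_image_le _ _).
  by apply: subset_card_le => -[|k] [[//]] _ _ kN; exists k.
rewrite /nth_vertex -/A AE; split; first by exists N.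
apply: card_eq_trans Nn.
rewrite (_ : [set v | _] = (fun k => p + ray d k) @` [set k | K k /\ (k <= N)%N]).
  by apply: inj_card_eq => i j _ _ /addrI /ray_inj.
apply/seteqP; split=> [_ [[k Kk <-]]|_ [k [Kk kN] <-]].
  by rewrite !dist_ray ler_nat; exists k.
by split; [exists k|rewrite !dist_ray ler_nat].
Qed.

(** A crude convexity bound, enough to make the set of lattice points on a segment finite. *)
Lemma segment_bound (u w v : vertex) :
  segment (Defs.point R u) (Defs.point R w) (Defs.point R v) ->
  `|v.1| <= `|u.1| + `|w.1| /\ `|v.2| <= `|u.2| + `|w.2|.
Proof.
have bound (x y z : int) (t : R) : 0 <= t <= 1 -> (1 - t) * x%:~R + t * y%:~R = z%:~R ->
    `|z| <= `|x| + `|y|.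
  move=> /andP[t0 t1] e; rewrite -(ler_int R) intrD !intr_norm -e.
  apply: le_trans (ler_normD _ _) _; rewrite !normrM.
  apply: lerD; apply: ler_piMl; rewrite ?normr_ge0// ger0_norm; lra.
move=> [t]; rewrite /= in_itv/= => t01 [e1 e2].
by split; apply: bound t01 _.
Qed.

Lemma finite_segment (u w : vertex) :
  finite_set [set v | segment (Defs.point R u) (Defs.point R w) (Defs.point R v)].
Proof.
have fin (M : int) : finite_set [set x : int | `|x| <= M].
  apply: (@sub_finite_set _ _ ((fun k : nat => k%:Z - M) @` `I_(absz (M + M + 1)%R))).
    by move=> x /= xM; exists (absz (x + M)); rewrite /=; lia.
  exact/finite_image/finite_II.
apply: (@sub_finite_set _ _ ([set x | `|x| <= `|u.1| + `|w.1|] `*`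
                             [set x | `|x| <= `|u.2| + `|w.2|])).
  by move=> v /segment_bound.
by apply: finite_setX; exact: fin.
Qed.

Lemma segment_between (x y z c : R) : y <= z <= x -> y < x ->
  segment (x, c) (y, c) (z, c) /\ segment (c, x) (c, y) (c, z).
Proof.
move=> /andP[yz zx] yx; have xy0 : x - y != 0 by rewrite subr_eq0 gt_eqF.
(* This parameter solves [(1 - t) * x + t * y = z]. *)
split; exists ((x - z) / (x - y)) => /=.
- by rewrite in_itv/= divr_ge0 ?subr_ge0 ?(ltW yx)//= ler_pdivrMr ?subr_gt0// mul1r lerB.
- by congr pair; field.
- by rewrite in_itv/= divr_ge0 ?subr_ge0 ?(ltW yx)//= ler_pdivrMr ?subr_gt0// mul1r lerB.
- by congr pair; field.
Qed.

(** Finiteness lets the path indices on the cross have a minimum and a maximum. The inclusion of the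
    lattice cross holds because every arm has length at least [n]. *)
Lemma nth_cross_exists (P : bipath) p n : meets_half_axes P -> (0 < n)%N ->
  exists C : set (R * R), [/\ nth_cross P p n C, finite_set [set v | C (Defs.point R v)] &
    forall v, lattice_cross p n v -> C (Defs.point R v)].
Proof.
move=> axes n0.
have /boolp.choice[N NP] : forall d, exists N,
    (n <= N)%N /\ nth_vertex R P p n d (p + ray d N).
  by move=> d; have [N nN] := nth_vertex_exists P p n d (axes d p) n0; exists N.
pose q d := p + ray d (N d).
exists (segment (Defs.point R (q xpos)) (Defs.point R (q xneg)) `|`
        segment (Defs.point R (q ypos)) (Defs.point R (q yneg))); split.
- by exists q => // d; case: (NP d).
- rewrite (_ : [set v | _] =
    [set v | segment (Defs.point R (q xpos)) (Defs.point R (q xneg)) (Defs.point R v)] `|`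
    [set v | segment (Defs.point R (q ypos)) (Defs.point R (q yneg)) (Defs.point R v)]) //.
  by rewrite finite_setU; split; exact: finite_segment.
- move=> v [vp v1 v2].
  have [nxp _] := NP xpos; have [nxn _] := NP xneg.
  have [nyp _] := NP ypos; have [nyn _] := NP yneg.
  rewrite /q /Defs.point; case: p v vp v1 v2 {NP q} => a b [x y] /= vp v1 v2.
  rewrite !addr0.
  case: vp => ->; [right|left].
    apply: (segment_between _ _ _ _ _ _).2; rewrite ?ler_int ?ltr_int; lia.
  apply: (segment_between _ _ _ _ _ _).1; rewrite ?ler_int ?ltr_int; lia.
Qed.
End crosses.

Lemma finite_int_bounds (X : set int) (i0 : int) : finite_set X -> X i0 ->
  exists a b, [/\ X a, X b & forall i, X i -> a <= i <= b].
Proof.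
move=> /finite_seqP[s ->] {X}; case: s => //= x s _.
elim: s x => [|y s IH] x.
  by exists x, x; split=> [||i]; rewrite /= inE// => /eqP ->; rewrite lexx.
have [a [b [/= Xa Xb ab]]] := IH y.
exists (Num.min x a), (Num.max x b); split.
- by rewrite /= inE; case: leP => _; rewrite ?eqxx// Xa orbT.
- by rewrite /= inE; case: leP => _; rewrite ?eqxx// Xb orbT.
- by move=> i; rewrite /= inE => /predU1P[->|/ab]; lia.
Qed.

(** * Snails as intervals of a path *)

Section snails.
Context {P : bipath} {f : int -> vertex}.
Hypothesis fP : parametrizes f P.

Definition interval_vset (a b : int) : set vertex := f @` [set i | a <= i <= b].

Definition interval_eset (a b : int) : set (set vertex) :=
  [set [set f i; f (i + 1)] | i in [set i | a <= i < b]].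

Lemma interval_eset_lattice a b : interval_eset a b `<=` lattice_edges.
Proof. by move=> _ [i _ <-]; apply: (@eset_lattice P); exact: param_edge. Qed.

Lemma interval_eset_vset a b e : interval_eset a b e -> e `<=` interval_vset a b.
Proof.
by move=> [i /= iab <-] _ [->|->]; [exists i|exists (i + 1)] => //=; lia.
Qed.

Definition interval_subgraph a b : subgraph :=
  Subgraph (@interval_eset_lattice a b) (@interval_eset_vset a b).

Lemma interval_has_length (a : int) (l : nat) :
  has_length (interval_subgraph a (a + l%:Z)) l.
Proof.
rewrite /has_length /=.
have -> : interval_eset a (a + l%:Z) =
    (fun k : nat => [set f (a + k%:Z); f (a + k%:Z + 1)]) @` `I_l.
  apply/seteqP; split=> [_ [i /= iab <-]|_ [k /= kl <-]]; last first.
    by exists (a + k%:Z) => //=; lia.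
  by exists (absz (i - a)) => /=; [lia|congr [set f _; f _]; lia].
(* Equal edges with different left ends would give both [i = j + 1] and [j = i + 1]. *)
apply: inj_card_eq => i j _ _ e.
have : [set f (a + j%:Z); f (a + j%:Z + 1)] (f (a + i%:Z)) by rewrite -e; left.
have : [set f (a + i%:Z); f (a + i%:Z + 1)] (f (a + j%:Z)) by rewrite e; left.
by move=> [] /(param_inj fP) ? [] /(param_inj fP) ?; lia.
Qed.

Lemma interval_connected_graph a b i : a <= i <= b ->
  connected_graph (interval_subgraph a b).
Proof.
move=> iab; split; first by exists (f i); exists i.
move=> _ _ [j jab <-] [k kab <-].
have [|s [ps ls] _] := @interval_connected (interval_subgraph a b) f j k a b jab kab.
  by move=> m mab; exists m.
by exists s.
Qed.

Lemma interval_included a b : included (interval_subgraph a b) P.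
Proof.
split; first by move=> _ [i _ <-]; exact: param_vset.
by move=> _ [i _ <-]; exact: param_edge.
Qed.

(** A walk in [G] joining [f a] to [f b] uses every path edge between them, by [walk_cover]. *)
Lemma interval_least (G : subgraph) a b : a <= b -> included G P ->
  connected_graph G -> vset G (f a) -> vset G (f b) ->
  included (interval_subgraph a b) G.
Proof.
move=> ab GP [_ Gc] Ga Gb; have [s ps ls] := Gc _ _ Ga Gb.
have edges i : a <= i < b -> eset G [set f i; f (i + 1)].
  by apply: (walk_cover fP _ _ _ _ s GP).
split; last by move=> _ [i iab <-]; exact: edges.
move=> _ [i /= /andP[ai ib] <-].
(* The right end [b] starts no edge of the interval; its vertex is in [G] by assumption. *)
case: (ltrP i b) => ib'; last by have -> : i = b by lia.
by apply: (eset_vset (edges i _)); [rewrite ai|left].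
Qed.

End snails.

Lemma snail_exists (R : realType) (P : bipath) (p : vertex) (n : nat) :
  meets_half_axes P -> vset P p -> (0 < n)%N ->
  exists S l, [/\ nth_snail R P p n S, has_length S l &
    forall v, vset P v -> lattice_cross p n v ->
      exists2 s, walk P p v s & (size s <= l)%N].
Proof.
move=> axes Pp n0; have [f fP] := bipathP P.
have [C [Ccross Cfin Cnear]] := nth_cross_exists R P p n axes n0.
have [i0 fi0] := param_surj fP p Pp.
have Cp : C (Defs.point R p) by apply: Cnear; split; [left|lia|lia].
pose X := [set i | C (Defs.point R (f i))].
have Xfin : finite_set X.
  apply: (@finite_preimage _ _ [set v | C (Defs.point R v)] f) => //.
  by move=> i j _ _ /(param_inj fP).
(* Both extreme indices are attained on the cross, so every admissible subgraph contains [f a] and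
   [f b]. This makes the interval from [a] to [b] the snail. *)
have [|a [b [Xa Xb ab]]] := @finite_int_bounds X i0 Xfin; first by rewrite /X /= fi0.
have /andP[ai0 i0b] : a <= i0 <= b by apply: ab; rewrite /X /= fi0.
exists (interval_subgraph fP a b), (absz (b - a)); split.
- exists C => //=; split.
    split=> //; [exact: interval_included| | |].
    + by apply: (@interval_connected_graph _ _ fP a b i0); rewrite ai0.
    + by exists i0; rewrite //= ai0.
    + move=> v Pv; have [i <-] := param_surj fP v Pv => Ci.
      by exists i => //; exact: ab.
  move=> G [GP Gc Gp GC]; apply: interval_least => //.
  + exact: le_trans i0b.
  + by apply: GC => //; exact: param_vset.
  + by apply: GC => //; exact: param_vset.
- rewrite {1}(_ : b = a + (absz (b - a))%:Z); last lia.
  exact: interval_has_length.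
- move=> v Pv vp; have [j fj] := param_surj fP v Pv.
  have jab : a <= j <= b by apply: ab; rewrite /X /= fj; exact: Cnear.
  have [|||s ws ss] := @interval_connected P f i0 j a b.
  + by rewrite ai0.
  + exact: jab.
  + by move=> k _; exact: param_edge.
  exists s; first by rewrite -fi0 -fj.
  lia.
Qed.

(** * Measurability and invariance *)

Lemma bigcup_countType_measurable {d} {T : measurableType d} {I : countType}
    (D : set I) (A : I -> set T) :
  (forall i, measurable (A i)) -> measurable (\bigcup_(i in D) A i).
Proof.
move=> mA; rewrite bigcup_mkcond; apply: countable_bigcupT_measurable => //.
by move=> i; case: ifP.
Qed.

Lemma bigcap_countType_measurable {d} {T : measurableType d} {I : countType}
    (D : set I) (A : I -> set T) :
  (forall i, measurable (A i)) -> measurable (\bigcap_(i in D) A i).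
Proof.
move=> mA; rewrite -[X in measurable X]setCK setC_bigcap; apply: measurableC.
by apply: bigcup_countType_measurable => i; exact: measurableC.
Qed.

Lemma ae_forall_countable {d} {T : measurableType d} {R : realType}
    (mu : {measure set T -> \bar R}) {I : countType} (Q : I -> T -> Prop) :
  (forall i, {ae mu, forall x, Q i x}) -> {ae mu, forall x, forall i, Q i x}.
Proof.
move=> aeQ.
have : {ae mu, forall x, forall n, if unpickle n is Some i then Q i x else True}.
  apply/ae_foralln => n; case: (unpickle n) => [i|]; first exact: aeQ.
  exact: aeW.
by apply: filterS => x Qx i; have := Qx (pickle i); rewrite pickleK.
Qed.

Lemma measurable_vset v : measurable [set P : path_space | vset (P : bipath) v].
Proof. by apply: sub_sigma_algebra; left; exists v. Qed.

Lemma measurable_eset e : measurable [set P : path_space | eset (P : bipath) e].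
Proof. by apply: sub_sigma_algebra; right; exists e. Qed.

Lemma measurable_walk u v s : measurable [set P : path_space | walk (P : bipath) u v s].
Proof.
elim: s u => [|x s IH] u.
  rewrite (_ : [set P | _] = [set P | u = v])//; last first.
    by apply/seteqP; split=> P //= [].
  have [->|uv] := pselect (u = v).
    by rewrite (_ : [set _ | _] = setT)//; apply/seteqP; split.
  by rewrite (_ : [set _ | _] = set0)//; apply/seteqP; split.
rewrite (_ : [set P | _] = [set P : path_space | eset (P : bipath) [set u; x]] `&`
   [set P : path_space | walk (P : bipath) x v s]).
  by apply: measurableI => //; exact: measurable_eset.
apply/seteqP; split=> P; rewrite /walk/=.
  by move=> [/andP[/set_mem ? ?] ?].
by move=> [/mem_set -> []].
Qed.

(** Vertices and finite lists of vertices are countable, so the event is built from cylinder events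
    by countable operations. *)
Lemma measurable_short_cross k n q : measurable (short_cross k n q : set path_space).
Proof.
have -> : short_cross k n q = [set P : path_space | vset (P : bipath) q] `&`
    \bigcap_(v in lattice_cross q n) (~` [set P : path_space | vset (P : bipath) v] `|`
      \bigcup_(s in [set s | (k * size s <= n ^ 2)%N])
        [set P : path_space | walk (P : bipath) q v s]).
  apply/seteqP; split=> P [Pq h]; split=> //.
    move=> v qv; have [Pv|] := pselect (vset (P : bipath) v); [right|by left].
    by have [s ws ks] := h v Pv qv; exists s.
  by move=> v Pv qv; have [//|[s ks ws]] := h v qv; exists s.
apply: measurableI; first exact: measurable_vset.
apply: bigcap_countType_measurable => v; apply: measurableU.
  by apply: measurableC; exact: measurable_vset.
by apply: bigcup_countType_measurable => s; exact: measurable_walk.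
Qed.

Lemma eset_shift z (P : bipath) u v :
  eset (Defs.shift z P) [set z + u; z + v] <-> eset P [set u; v].
Proof.
rewrite -translate2; split=> [[e Ee /(congr1 (translate (- z)))]|Eij].
  by rewrite !translateK => <-.
by exists [set u; v].
Qed.

Lemma walk_shift z (P : bipath) u v s :
  walk (Defs.shift z P) (z + u) (z + v) (map (+%R z) s) <-> walk P u v s.
Proof.
rewrite /walk path_map last_map (@eq_path _ _ (fun x y => [set x; y] \in eset P)).
  by split=> -[? h]; split=> //; [exact: addrI h|rewrite h].
move=> x y /=; apply/idP/idP => /set_mem h; apply/mem_set; exact/(eset_shift z).
Qed.

(** Combined with invariance of the measure, this makes the probability of [short_cross k n q]
    independent of [q]. *)
Lemma short_cross_shift k n q z :
  Defs.shift z @^-1` (short_cross k n (z + q)) = short_cross k n q.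
Proof.
have subDD (x y t : int) : (x + y) - (x + t) = y - t by lia.
have crossD v : lattice_cross (z + q) n (z + v) <-> lattice_cross q n v.
  rewrite /lattice_cross /= !subDD.
  by split=> -[[e|e] ? ?]; split=> //; [left|right|left|right]; lia.
apply/seteqP; split=> P /= [].
  move=> [w Pw /addrI wq] h; rewrite wq in Pw; split=> // v Pv vq.
  have [||s ws ks] := h (z + v); first by exists v.
    exact/crossD.
  exists (map (+%R (- z)) s); last by rewrite size_map.
  rewrite -(walk_shift z) -map_comp (@eq_map _ _ _ id) ?map_id//.
  by move=> x /=; rewrite addNKr.
move=> Pq h; split; first by exists q.
move=> _ [v Pv <-] /crossD vq; have [s /(walk_shift z) ws ks] := h v Pv vq.
by exists (map (+%R z) s); rewrite ?size_map.
Qed.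

(** The sum is the expected number of events that occur, and the pointwise bound integrates against
    total mass 1. *)
Lemma sum_measure_le {d} {T : measurableType d} {R : realType} (mu : probability T R)
    {I : finType} (A : I -> set T) (M : R) : (forall i, measurable (A i)) ->
  (forall x, \sum_i (`[< A i x >]%:R : R) <= M) ->
  (\sum_i mu (A i) <= M%:E)%E.
Proof.
move=> mA AM.
have -> : (\sum_i mu (A i) = \int[mu]_x (\sum_i (\1_(A i) x)%:E))%E.
  rewrite ge0_integral_sum//.
  - by apply: eq_bigr => i _; rewrite integral_indic// setIT.
  - by move=> i; apply/measurable_EFinP; exact: measurable_indic.
rewrite -[leRHS]mule1 -(probability_setT mu) -integral_cst//.
apply: ge0_le_integral => //.
- by move=> x _; apply: sume_ge0.
- by apply: emeasurable_sum => i; apply/measurable_EFinP; exact: measurable_indic.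
- move=> x _; rewrite sumEFin lee_fin; apply: le_trans (AM x).
  apply: ler_sum => i _; rewrite indicE.
  by case: asboolP => h; rewrite ?(mem_set h) ?(memNset h).
Qed.

Lemma infinite_nat_unbounded (K : set nat) :
  (forall M, exists2 n, K n & (M <= n)%N) -> infinite_set K.
Proof.
move=> unbounded /finite_seqP[s Ks].
have [n Kn sn] := unbounded (\max_(i <- s) i).+1.
by move: sn; rewrite ltnNge leq_bigmax_seq//; move: Kn; rewrite Ks.
Qed.

(** * Probability bounds for short crosses *)

Section measure_bounds.
Context {R : realType} {mu : probability path_space R}.
Hypothesis mu_invariant : translation_invariant mu.

Lemma short_cross_le k n q : (0 < k)%N -> (k <= n ^ 2)%N ->
  (mu (short_cross k n q) <= (Num.sqrt (160%:R / k%:R))%:E)%E.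
Proof.
move=> k0 kn; have n0 : (0 < n)%N by case: n kn => //; rewrite leqn0; case: k k0.
pose v (ij : 'I_n * 'I_n) : vertex := (ij.1%:Z, ij.2%:Z).
have muE ij : mu (short_cross k n (v ij)) = mu (short_cross k n q).
  rewrite -(short_cross_shift k n q (v ij - q)) addrNK mu_invariant//.
  by rewrite -(addrNK q (v ij)); exact: measurable_short_cross.
have := @sum_measure_le _ _ _ mu _ (fun ij => short_cross k n (v ij))
  ((n ^ 2)%:R * Num.sqrt (160%:R / k%:R)) (fun ij => measurable_short_cross k n (v ij)).
under eq_bigr do rewrite muE.
have -> : mu (short_cross k n q) = (fine (mu (short_cross k n q)))%:E.
  by rewrite fineK// fin_num_measure//; exact: measurable_short_cross.
rewrite sumEFin !lee_fin sumr_const card_prod card_ord mulnn => le.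
have N0 : 0 < (n ^ 2)%:R :> R by rewrite ltr0n expn_gt0 n0.
rewrite -(ler_pM2l N0) [leLHS]mulr_natl; apply: le => P.
rewrite -natr_sum; have := short_cross_count P k n k0.
rewrite -/(v _); set c := (\sum_ij _)%N => c2.
(* Here [k * (4 * (n ^ 2 %/ k) + 1) <= 4 * n ^ 2 + k <= 5 * n ^ 2], using [k <= n ^ 2], and
   [32 * 5 = 160]. *)
have kc2 : (k * c ^ 2 <= 160 * n ^ 4)%N.
  apply: leq_trans (leq_mul (leqnn k) c2) _.
  have := leq_trunc_div (n ^ 2) k; rewrite (expnM n 2 2).
  move: (n ^ 2)%N kn (n ^ 2 %/ k)%N => N kN M kM.
  nia.
rewrite -ler_sqr ?nnegrE ?ler0n ?mulr_ge0 ?sqrtr_ge0//.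
rewrite exprMn sqr_sqrtr ?divr_ge0 ?ler0n// mulrA ler_pdivlMr ?ltr0n//.
by rewrite -!natrX -!natrM ler_nat -expnM mulnC [leqRHS]mulnC.
Qed.

Definition eventually_short k p : set path_space :=
  \bigcup_N \bigcap_(n in [set n | (N <= n)%N]) short_cross k n p.

Lemma eventually_short_measurable k p : measurable (eventually_short k p).
Proof.
apply: bigcup_countType_measurable => N; apply: bigcap_countType_measurable => n.
exact: measurable_short_cross.
Qed.

(** Continuity from below along the increasing events [F N] reduces the bound to a single radius. *)
Lemma eventually_short_le k p : (0 < k)%N ->
  (mu (eventually_short k p) <= (Num.sqrt (160%:R / k%:R))%:E)%E.
Proof.
move=> k0.
pose F N : set path_space := \bigcap_(n in [set n | (N <= n)%N]) short_cross k n p.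
have mF N : measurable (F N).
  by apply: bigcap_countType_measurable => n; exact: measurable_short_cross.
have ndF : nondecreasing_seq F.
  move=> M N MN; rewrite subsetEset => P FP n /= Nn; apply: FP.
  exact: leq_trans Nn.
apply: (cvge_le _ (nondecreasing_cvg_mu mF (eventually_short_measurable k p) ndF)).
exists 0%N => // N _ /=.
(* The radius [N + k] is at least [N], so its event contains [F N], and its square is at least [k],
   as [short_cross_le] requires. *)
apply: le_trans (short_cross_le k (N + k) p k0 _); last first.
  by rewrite -mulnn; nia.
apply: le_measure; rewrite ?inE//; first exact: measurable_short_cross.
by move=> P; apply; rewrite /= leq_addr.
Qed.

Lemma always_eventually_short_null p :
  {ae mu, forall P, ~ (forall k, eventually_short k.+1 p P)}.
Proof.
pose B : set path_space := \bigcap_k eventually_short k.+1 p.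
have mB : measurable B.
  by apply: bigcap_countType_measurable => k; exact: eventually_short_measurable.
exists B; split => //; last by move=> P /= /contrapT BP k _; exact: BP.
(* The bound by [sqrt (160 / k.+1)] is squared and cleared of its denominator; letting [k] grow then
   forces [mu B = 0]. *)
have muB k : fine (mu B) ^+ 2 * k.+1%:R <= 160%:R.
  rewrite -ler_pdivlMr ?ltr0n// -[leRHS]sqr_sqrtr ?divr_ge0 ?ler0n//.
  rewrite ler_sqr ?nnegrE ?sqrtr_ge0 ?fine_ge0//.
  rewrite -lee_fin fineK ?fin_num_measure//.
  apply: le_trans (eventually_short_le k.+1 p _) => //.
  apply: le_measure; rewrite ?inE//; first exact: eventually_short_measurable.
  by move=> P; apply.
rewrite -[LHS]fineK ?fin_num_measure//; congr EFin.
apply/eqP; rewrite -sqrf_eq0; apply/negP => /negP muB0.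
have b0 : 0 < fine (mu B) ^+ 2 by rewrite lt_def muB0 sqr_ge0.
(* With [k] the integer part of [160 / mu(B)^2], [k + 1] exceeds that quotient, a contradiction. *)
have := muB (Num.truncn (160%:R / fine (mu B) ^+ 2)).
by rewrite mulrC -ler_pdivlMr// leNgt truncnS_gt.
Qed.

End measure_bounds.

(** * From short crosses to long snails *)

Lemma long_snails (R : realType) (P : bipath) (p : vertex) (k : nat) :
  meets_half_axes P -> vset P p -> ~ eventually_short k.+1 p P ->
  infinite_set [set n : nat | (0 < n)%N /\
    exists (S : subgraph) (l : nat),
      [/\ nth_snail R P p n S, has_length S l & k.+1%:R^-1 * n%:R ^+ 2 <= l%:R :> R]].
Proof.
move=> axes Pp notshort; apply: infinite_nat_unbounded => M.
(* If no long snail occurs from [M] on, then for [n > M] the snail has length below [n ^ 2 / k.+1]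
   and contains walks from [p] to all path vertices of the lattice cross. Starting at [M.+1] also
   keeps [n] positive. *)
apply: contrapT => noM; apply: notshort; exists M.+1 => // n /= Mn.
split=> // v Pv vn; have n0 : (0 < n)%N by exact: leq_trans Mn.
have [S [l [Ssnail Sl walks]]] := snail_exists R P p n axes Pp n0.
have [s ws sl] := walks v Pv vn; exists s => //.
rewrite leqNgt; apply/negP => ks; apply: noM; exists n; last exact: ltnW.
split=> //; exists S, l; split=> //.
rewrite mulrC ler_pdivrMr ?ltr0n// -natrX -natrM ler_nat mulnC.
by apply: leq_trans (ltnW ks) _; rewrite leq_mul2l sl orbT.
Qed.

Theorem theorem2 (R : realType) (mu : probability path_space R)
    (mu_invariant : translation_invariant mu)
    (mu_axes : {ae mu, forall P : path_space, meets_half_axes P}) :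
  {ae mu, forall P : path_space, forall p : vertex, vset (P : bipath) p ->
    exists2 c : R, 0 < c &
      infinite_set [set n : nat | (0 < n)%N /\
        exists (S : subgraph) (l : nat),
          [/\ nth_snail R P p n S, has_length S l & c * n%:R ^+ 2 <= l%:R]]}.
Proof.
(* There are countably many vertices, so one null set serves all [p]. *)
have := @ae_forall_countable _ _ _ mu vertex _
  (always_eventually_short_null mu_invariant).
pose aeF : Filter (almost_everywhere mu) := ae_filter_ringOfSetsType mu.
apply: (@filterS2 _ _ aeF) mu_axes => P axes notshort p Pp.
have /existsNP[k nk] := notshort p.
(* Here [k] is an index for which [eventually_short k.+1 p] fails at [P]; it depends on both [p] and
   [P], hence so does the constant. *)
exists k.+1%:R^-1; first by rewrite invr_gt0 ltr0n.
exact: long_snails.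
Qed.
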